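(* Let $(u,p)\in C^\infty(\mathbb{R}^2;\mathbb{R}^2)\times C^\infty(\mathbb{R}^2)$ be a smooth solution of the stationary damped Euler system $$ \begin{cases} u\cdot\nabla u+u+\nabla p=0, & x\in\mathbb{R}^2,\\ \operatorname{div}u=0, & x\in\mathbb{R}^2. \end{cases} $$ Assume that $$\liminf_{R\to\infty}\frac1R\int_{B_{2R}\setminus B_R}|u(x)|\,dx=0.$$ Then $u\equiv0$ and $p$ is constant. In particular, the conclusion ($u\equiv 0$ and $p$ constant) holds if $u\in L^r(\mathbb{R}^2;\mathbb{R}^2)$ for some $1\le r\le2$.
   Context: $p$ is real-valued, and $B_R$ denotes the ball of radius $R$ centered at the origin in $\mathbb{R}^2$. *)

(* Defs.v *)
From HB Require Import structures.
From mathcomp Require Import all_boot all_order all_algebra.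
From mathcomp Require Import all_classical all_reals all_analysis.

Set Implicit Arguments.
Unset Strict Implicit.
Unset Printing Implicit Defensive.

Import Order.TTheory GRing.Theory Num.Theory.
Import numFieldNormedType.Exports.

Local Open Scope classical_set_scope.
Local Open Scope ring_scope.

Section Plane.
Context (R : realType).

(* The norm `|x| that the library puts on R * R is the sup norm; the two norms
   induce the same topology, but Euclidean balls need this one. *)
Definition enorm (x : R * R) : R := Num.sqrt (x.1 ^+ 2 + x.2 ^+ 2).

Definition eball (r : R) : set (R * R) := [set x | enorm x < r].

(* Lebesgue measure on the plane; measurableTypeR R, the type of the points it
   integrates over, is R with its Borel sigma-algebra. *)
Local Notation lebesgue2 := (@lebesgue_measure R \x @lebesgue_measure R)%E.

Definition partial1 (f : R * R -> R) (x : R * R) : R := 'D_(1, 0) f x.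
Definition partial2 (f : R * R -> R) (x : R * R) : R := 'D_(0, 1) f x.

(* All partial derivatives of order at most k exist and are continuous.  The
   derivability clauses are needed because 'D is total. *)
Fixpoint Ck (k : nat) (f : R * R -> R) : Prop :=
  match k with
  | 0%N => continuous f
  | k'.+1 =>
      [/\ continuous f,
          forall x, derivable f x (1, 0),
          forall x, derivable f x (0, 1),
          Ck k' (partial1 f)
        & Ck k' (partial2 f)]
  end.

Definition smooth (f : R * R -> R) : Prop := forall k, Ck k f.

Definition comp1 (u : R * R -> R * R) (x : R * R) : R := (u x).1.
Definition comp2 (u : R * R -> R * R) (x : R * R) : R := (u x).2.

Definition smooth_field (u : R * R -> R * R) : Prop :=
  smooth (comp1 u) /\ smooth (comp2 u).

Definition grad (p : R * R -> R) (x : R * R) : R * R :=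
  (partial1 p x, partial2 p x).

Definition divergence (u : R * R -> R * R) (x : R * R) : R :=
  partial1 (comp1 u) x + partial2 (comp2 u) x.

Definition dot (x y : R * R) : R := x.1 * y.1 + x.2 * y.2.

(* (u . nabla) u *)
Definition convection (u : R * R -> R * R) (x : R * R) : R * R :=
  (dot (u x) (grad (comp1 u) x), dot (u x) (grad (comp2 u) x)).

Definition damped_euler (u : R * R -> R * R) (p : R * R -> R) : Prop :=
  (forall x, convection u x + u x + grad p x = 0) /\
  (forall x, divergence u x = 0).

Definition annulus_mean (u : R * R -> R * R) (r : R) : \bar R :=
  ((r^-1)%:E *
   \int[lebesgue2]_(x in eball (2 * r) `\` eball r) (enorm (u x))%:E)%E.

Definition Lr_field (r : R) (u : R * R -> R * R) : Prop :=
  measurable_fun [set: measurableTypeR R * measurableTypeR R] u /\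
  finite_norm lebesgue2 r%:E (enorm \o u).

Definition trivial_solution (u : R * R -> R * R) (p : R * R -> R) : Prop :=
  (forall x, u x = 0) /\ (exists c : R, forall x, p x = c).

End Plane.

(* Main.v *)
(* Taking the scalar product of the momentum equation with u shows that the
   Bernoulli function B = p + |u|^2 / 2 satisfies u . grad B = - |u|^2.  As u is
   divergence free, div (u atan B) = - |u|^2 / (1 + B^2), and since atan is
   bounded, testing against a cutoff supported in B_2R gives
     \int_(B_R) |u|^2 / (1 + B^2) <= (C / R) \int_(B_2R \ B_R) |u|.
   Letting R go to infinity along a suitable sequence yields u = 0, hence
   grad p = 0.  For u in L^r with 1 <= r <= 2, the pointwise inequality
   |u| <= d / R + (R / d) |u|^r bounds the annulus mean by
   16 d + (1 / d) \int_(B_2R \ B_R) |u|^r, and the last integral is a tail. *)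
Require Import Defs.
From mathcomp Require Import all_boot all_order all_algebra.
From mathcomp Require Import all_classical all_reals all_analysis.
From mathcomp Require Import measurable_realfun ring lra.
Import Order.TTheory GRing.Theory Num.Theory.
Import numFieldNormedType.Exports.
Local Open Scope classical_set_scope.
Local Open Scope ring_scope.

Section Plane.
Context (R : realType).

Local Notation plane := (measurableTypeR R * measurableTypeR R)%type.
Local Notation lebesgue2 := (@lebesgue_measure R \x @lebesgue_measure R)%E.

(** * Borel measurability and integrability of continuous functions on the plane *)

Lemma ball_prodE (z : R * R) (e : R) : ball z e = ball z.1 e `*` ball z.2 e.
Proof. by apply/seteqP; split. Qed.

Lemma measurable_ball_plane (z : R * R) (e : R) :
  measurable (ball z e : set plane).
Proof. by rewrite ball_prodE; apply: measurableX; apply: open_measurable; exact: ball_open. Qed.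

(** Measurability here refers to the product sigma-algebra, openness to the product topology. The
    two are linked by writing an open set as a countable union of sup-norm balls, which are products
    of intervals, with rational centres and radii. *)
Lemma open_measurable_plane (U : set (R * R)) :
  open U -> measurable (U : set plane).
Proof.
move=> oU.
pose c (q : (rat * rat) * rat) : R * R := (ratr q.1.1, ratr q.1.2).
pose B (q : (rat * rat) * rat) : set plane :=
  if `[< ball (c q) (ratr q.2) `<=` U >] then ball (c q) (ratr q.2) else set0.
have -> : U = \bigcup_(q in [set: (rat * rat) * rat]) B q.
  apply/seteqP; split => [[x y] Uxy|z [q _]]; last first.
    by rewrite /B; case: ifPn => // /asboolP qU; exact: qU.
  have /nbhs_ballP[e /= e0 eU] := open_nbhs_nbhs (conj oU Uxy).
  have dense_near (a b : R) : a < b -> exists q : rat, a < ratr q < b.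
    by move=> ab; have [q] := rat_in_itvoo ab; rewrite in_itv/= => ?; exists q.
  (* The rational centre is within e/4 of the point in each coordinate and the radius lies between
     e/4 and e/2. So the ball contains the point and stays within 3e/4 of it. *)
  have [q1 /andP[q1l q1u]] := @dense_near (x - e / 4) (x + e / 4) ltac:(lra).
  have [q2 /andP[q2l q2u]] := @dense_near (y - e / 4) (y + e / 4) ltac:(lra).
  have [d /andP[dl du]] := @dense_near (e / 4) (e / 2) ltac:(lra).
  exists ((q1, q2), d) => //; rewrite /B /c/= ifT; last first.
    apply/asboolP => -[x' y'] [/=]; rewrite /ball/= => b1 b2.
    apply: eU; split; rewrite /ball/=.
      by move: b1; rewrite !ltr_distlC => /andP[? ?]; apply/andP; split; lra.
    by move: b2; rewrite !ltr_distlC => /andP[? ?]; apply/andP; split; lra.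
  by split; rewrite /ball/= ltr_distlC; apply/andP; split; lra.
apply: countable_bigcupT_measurable => // q; rewrite /B; case: ifPn => // _.
exact: measurable_ball_plane.
Qed.

Lemma continuous_measurable_plane (f : R * R -> R) :
  continuous f -> measurable_fun [set: plane] f.
Proof.
move=> /continuousP cf; apply: (measurability _ (RGenOpens.measurableE R)).
move=> _ [_ [a [b ->] <-]]; rewrite setTI.
by apply: open_measurable_plane; apply: cf; exact: interval_open.
Qed.

(** As the norm is the sup norm, [f] is carried by the square [K], which is compact and has finite
    measure; a continuous function is bounded there. *)
Lemma continuous_integrable_plane (f : R * R -> R) (A : R) :
  continuous f -> (forall z, A <= `|z| -> f z = 0) ->
  lebesgue2.-integrable [set: plane] (EFin \o f).
Proof.
move=> cf f0.
pose K : set plane := `[- A, A]%classic `*` `[- A, A]%classic.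
have mK : measurable K by exact: measurableX.
have -> : EFin \o f = (EFin \o f) \_ K.
  apply/funext => -[x y]; rewrite patchE; case: ifPn => //.
  rewrite notin_setE => nK; rewrite /= f0// leNgt; apply/negP => xyA.
  apply: nK; move: xyA; rewrite prod_normE/= gt_max => /andP[xA yA].
  by split; rewrite /= in_itv/=; rewrite -ler_norml ltW.
apply: (integrable_mkcond (mu := lebesgue2) (EFin \o f : plane -> _) mK).1.
apply: measurable_bounded_integrable => //.
- rewrite [ltLHS]product_measure1E//.
  have AAfin : (@lebesgue_measure R (`[(- A)%R, A]%classic) < +oo)%E.
    by apply: compact_finite_measure; exact: segment_compact.
  by rewrite lte_mul_pinfty// ge0_fin_numE.
- by apply: measurable_funTS; exact: continuous_measurable_plane.
- have /compact_bounded : compact (f @` (K : set (R * R))).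
    apply: continuous_compact; first exact: continuous_subspaceT.
    by apply: compact_setX; exact: segment_compact.
  move=> [M [Mr MB]]; exists M; split => // x /MB Mx z Kz.
  by apply: Mx; exists z.
Qed.

(** * Derivatives of compactly supported functions have zero integral *)

Lemma integral_derivative_compact_support (F f : R -> R) (A : R) :
  continuous f -> (forall x : R, is_derive x 1 F (f x)) ->
  (forall x : R, A <= `|x| -> F x = 0 /\ f x = 0) ->
  (\int[@lebesgue_measure R]_x (f x)%:E = 0)%E.
Proof.
move=> cf dF Ff0.
wlog A0 : A Ff0 / 0 < A.
  move=> /(_ (Num.max A 1)); apply; last by rewrite lt_max ltr01 orbT.
  by move=> x; rewrite ge_max => /andP[+ _]; exact: Ff0.
have -> : (fun x => (f x)%:E) = (fun x => (f x)%:E) \_ `[- A, A].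
  apply/funext => x; rewrite patchE; case: ifPn => //.
  rewrite notin_setE/= in_itv/= => /negP; rewrite -ler_norml -ltNge => /ltW.
  by move=> /Ff0[_ ->].
have cF x : {for x, continuous F}.
  by apply: differentiable_continuous; apply/derivable1_diffP; case: (dF x).
rewrite -integral_mkcond (@continuous_FTC2 _ f F)//.
- have [-> _] : F A = 0 /\ f A = 0 by apply: Ff0; exact: ler_norm.
  have [-> _] : F (- A) = 0 /\ f (- A) = 0.
    by apply: Ff0; rewrite normrN ler_norm.
  by rewrite subee.
- lra.
- exact: continuous_subspaceT.
- split=> [x _||]; first by case: (dF x).
  + by apply: cvg_at_right_filter; exact: cF.
  + by apply: cvg_at_left_filter; exact: cF.
- by move=> x _; rewrite derive1E; case: (dF x).
Qed.

(** The partial derivatives are explicit functions, and differentiability is stated on horizontal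
    and vertical lines. This is the form to which Fubini and the one-variable rules apply. *)
Definition C1 (f fx fy : R * R -> R) : Prop :=
  [/\ continuous f, continuous fx, continuous fy,
      forall x y : R, is_derive x 1 (fun s => f (s, y)) (fx (x, y))
    & forall x y : R, is_derive y 1 (fun s => f (x, s)) (fy (x, y))].

Lemma continuous_slice1 (f : R * R -> R) (y : R) :
  continuous f -> continuous (fun s => f (s, y)).
Proof.
move=> cf x; apply: (@continuous_comp R (R * R)%type R (fun s => (s, y)) f); last exact: cf.
by apply: (@cvg_pair _ _ _ _ (nbhs x) (nbhs y)); [exact: cvg_id|exact: cvg_cst].
Qed.

Lemma continuous_slice2 (f : R * R -> R) (x : R) :
  continuous f -> continuous (fun s => f (x, s)).
Proof.
move=> cf y; apply: (@continuous_comp R (R * R)%type R (fun s => (x, s)) f); last exact: cf.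
by apply: (@cvg_pair _ _ _ _ (nbhs x) (nbhs y)); [exact: cvg_cst|exact: cvg_id].
Qed.

Lemma prod_norm_ge (x y : R) : `|x| <= `|(x, y)| /\ `|y| <= `|(x, y)|.
Proof. by rewrite prod_normE/= !le_max !lexx orbT. Qed.

(** By Fubini, integrate first in the variable of differentiation: each inner integral is that of
    the derivative of a compactly supported function of one variable. *)
Lemma integral_partial_compact_support (f fx fy : R * R -> R) (A : R) :
  C1 f fx fy -> (forall z, A <= `|z| -> [/\ f z = 0, fx z = 0 & fy z = 0]) ->
  (\int[lebesgue2]_z (fx z)%:E = 0 /\ \int[lebesgue2]_z (fy z)%:E = 0)%E.
Proof.
move=> [cf cfx cfy dfx dfy] f0; split.
- have ifx : lebesgue2.-integrable [set: plane] (EFin \o fx).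
    by apply: (@continuous_integrable_plane _ A) => // z /f0[].
  have <- := integral21_prod_meas1 ifx.
  rewrite (eq_integral (cst 0%E)) ?integral0// => y _ /=.
  apply: (@integral_derivative_compact_support (fun s => f (s, y))
    (fun s => fx (s, y)) A).
  + exact: continuous_slice1.
  + by move=> x Ax; have [] := f0 (x, y) (le_trans Ax (prod_norm_ge x y).1).
- have ify : lebesgue2.-integrable [set: plane] (EFin \o fy).
    by apply: (@continuous_integrable_plane _ A) => // z /f0[].
  have <- := integral12_prod_meas1 ify.
  rewrite (eq_integral (cst 0%E)) ?integral0// => x _ /=.
  apply: (@integral_derivative_compact_support (fun s => f (x, s))
    (fun s => fy (x, s)) A).
  + exact: continuous_slice2.
  + by move=> y Ay; have [] := f0 (x, y) (le_trans Ay (prod_norm_ge x y).2).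
Qed.

(** * Differentiation rules for [C1] functions *)

Lemma C1_fst : C1 (fun z => z.1) (fun=> 1) (fun=> 0).
Proof.
split => [z|z|z|x y|x y]; [exact: cvg_fst|exact: cvg_cst|exact: cvg_cst|..].
- exact: is_derive_id.
- exact: is_derive_cst.
Qed.

Lemma C1_snd : C1 (fun z => z.2) (fun=> 0) (fun=> 1).
Proof.
split => [z|z|z|x y|x y]; [exact: cvg_snd|exact: cvg_cst|exact: cvg_cst|..].
- exact: is_derive_cst.
- exact: is_derive_id.
Qed.

Lemma C1_cst (c : R) : C1 (fun=> c) (fun=> 0) (fun=> 0).
Proof.
by split => [z|z|z|x y|x y]; by [exact: cvg_cst|exact: is_derive_cst].
Qed.

Lemma C1D {f fx fy g gx gy : R * R -> R} : C1 f fx fy -> C1 g gx gy ->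
  C1 (fun z => f z + g z) (fun z => fx z + gx z) (fun z => fy z + gy z).
Proof.
move=> [cf cfx cfy dfx dfy] [cg cgx cgy dgx dgy].
split => [z|z|z|x y|x y].
- by apply: cvgD; [exact: cf|exact: cg].
- by apply: cvgD; [exact: cfx|exact: cgx].
- by apply: cvgD; [exact: cfy|exact: cgy].
- exact: is_deriveD (dfx x y) (dgx x y).
- exact: is_deriveD (dfy x y) (dgy x y).
Qed.

Lemma C1M {f fx fy g gx gy : R * R -> R} : C1 f fx fy -> C1 g gx gy ->
  C1 (fun z => f z * g z) (fun z => f z * gx z + g z * fx z)
     (fun z => f z * gy z + g z * fy z).
Proof.
move=> [cf cfx cfy dfx dfy] [cg cgx cgy dgx dgy].
split => [z|z|z|x y|x y].
- by apply: cvgM; [exact: cf|exact: cg].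
- apply: cvgD; apply: cvgM;
    by [exact: cf|exact: cg|exact: cfx|exact: cgx].
- apply: cvgD; apply: cvgM;
    by [exact: cf|exact: cg|exact: cfy|exact: cgy].
- exact: is_deriveM (dfx x y) (dgx x y).
- exact: is_deriveM (dfy x y) (dgy x y).
Qed.

Lemma C1_comp {phi dphi : R -> R} {f fx fy : R * R -> R} :
  (forall s : R, is_derive s 1 phi (dphi s)) -> continuous dphi ->
  C1 f fx fy ->
  C1 (fun z => phi (f z)) (fun z => dphi (f z) * fx z)
     (fun z => dphi (f z) * fy z).
Proof.
move=> dp cdp [cf cfx cfy dfx dfy].
have cp : continuous phi.
  move=> s; apply: differentiable_continuous; apply/derivable1_diffP.
  by case: (dp s).
have cdpf z : {for z, continuous (fun z => dphi (f z))}.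
  by apply: continuous_comp; [exact: cf|exact: cdp].
split => [z|z|z|x y|x y].
- by apply: continuous_comp; [exact: cf|exact: cp].
- by apply: cvgM; [exact: cdpf|exact: cfx].
- by apply: cvgM; [exact: cdpf|exact: cfy].
- exact: is_derive1_comp (dp _) (dfx x y).
- exact: is_derive1_comp (dp _) (dfy x y).
Qed.

(** The difference quotient along (1, 0) or (0, 1) is the very function that defines the derivative
    of the corresponding slice, so existence and value carry over. *)
Lemma Ck_C1 {f : R * R -> R} :
  Ck 1 f -> C1 f (@partial1 R f) (@partial2 R f).
Proof.
move=> [cf d1 d2 c1 c2]; split => // x y.
- have dE : (fun h : R => h^-1 *: (f (h *: (1, 0) + (x, y)) - f (x, y))) =
            (fun h : R => h^-1 *: (f (h *: (1 : R) + x, y) - f (x, y))).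
    by apply/funext => h; congr (_ *: (f _ - _)); congr pair => /=;
      rewrite ?scaler0 ?add0r.
  apply: DeriveDef; first by have := d1 (x, y); rewrite /derivable dE.
  by rewrite /partial1 /derive dE.
- have dE : (fun h : R => h^-1 *: (f (h *: (0, 1) + (x, y)) - f (x, y))) =
            (fun h : R => h^-1 *: (f (x, h *: (1 : R) + y) - f (x, y))).
    by apply/funext => h; congr (_ *: (f _ - _)); congr pair => /=;
      rewrite ?scaler0 ?add0r.
  apply: DeriveDef; first by have := d2 (x, y); rewrite /derivable dE.
  by rewrite /partial2 /derive dE.
Qed.

(** * The cutoff function and its gradient *)

Definition spos (s : R) : R := Num.max 0 s.

(** The first-order remainder of the squared positive part is at most h^2, uniformly in [s], so the
    corner at 0 needs no separate treatment. *)
Lemma is_derive_spos_sqr (s : R) :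
  is_derive s 1 (fun t => spos t ^+ 2) (2 * spos s).
Proof.
have bnd (h : R) :
    `|spos (h + s) ^+ 2 - spos s ^+ 2 - h * (2 * spos s)| <= h ^+ 2.
  rewrite /spos ler_norml.
  by apply/andP; split; case: (leP 0 s); case: (leP 0 (h + s)); nra.
have lim : (fun h : R => h^-1 *: (spos (h *: (1 : R) + s) ^+ 2 - spos s ^+ 2))
    @ 0^' --> 2 * spos s.
  apply/cvgrPdist_le => e e0; near=> h.
  have h0 : h != 0 by near: h; exact: nbhs_dnbhs_neq.
  rewrite [h *: 1]mulr1 distrC -[_ *: _](mulrC _ h^-1).
  have -> : (spos (h + s) ^+ 2 - spos s ^+ 2) * h^-1 - 2 * spos s =
      (spos (h + s) ^+ 2 - spos s ^+ 2 - h * (2 * spos s)) / h by field.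
  rewrite normrM normfV ler_pdivrMr ?normr_gt0// (le_trans (bnd h))//.
  rewrite -real_normK ?num_real// expr2 ler_wpM2r//.
  by near: h; apply: dnbhs0_le.
split; first by apply/cvg_ex; exists (2 * spos s).
exact: cvg_lim.
Unshelve. all: by end_near. Qed.

Lemma cvg_sqr {T : Type} (F : set_system T) {FF : Filter F} (f : T -> R) (l : R) :
  f @ F --> l -> (fun x => f x ^+ 2) @ F --> l ^+ 2.
Proof. by move=> fl; rewrite expr2; apply: cvgM. Qed.

Lemma continuous_spos : continuous spos.
Proof.
by move=> s; apply: continuous_max; [exact: cvg_cst|exact: cvg_id].
Qed.

Lemma C1_ext {f fx fy g gx gy : R * R -> R} :
  f =1 g -> fx =1 gx -> fy =1 gy -> C1 f fx fy -> C1 g gx gy.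
Proof. by move=> /funext -> /funext -> /funext ->. Qed.

(** Affine in |z|^2: nonpositive exactly on |z| <= r for r > 0, equal to 1 where |z|^2 = 2 r^2, and
    equal to 3 on |z| = 2 r. *)
Definition ring_coord (r : R) (z : R * R) : R :=
  (z.1 ^+ 2 + z.2 ^+ 2) / r ^+ 2 - 1.

(* Squaring the positive part makes this C^1; it is 1 for |z| <= r and 0 for
   |z|^2 >= 2 r^2. *)
Definition cutoff (r : R) (z : R * R) : R :=
  spos (1 - spos (ring_coord r z) ^+ 2) ^+ 2.

(** The radial factor of the gradient: grad [cutoff] is [cutoff_slope] times z. The constant is 2 *
    (-2) from the two squares, times 2 / r^2 from [ring_coord]. *)
Definition cutoff_slope (r : R) (z : R * R) : R :=
  - 8 / r ^+ 2 * (spos (1 - spos (ring_coord r z) ^+ 2) * spos (ring_coord r z)).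

Lemma C1_cutoff (r : R) :
  C1 (cutoff r) (fun z => cutoff_slope r z * z.1)
                (fun z => cutoff_slope r z * z.2).
Proof.
have c2 : continuous (fun s : R => 2 * spos s).
  by move=> s; apply: cvgM; [exact: cvg_cst|exact: continuous_spos].
have Ct := C1D (C1M (C1D (C1M C1_fst C1_fst) (C1M C1_snd C1_snd))
  (C1_cst (r ^+ 2)^-1)) (C1_cst (- 1)).
have Cs := C1D (C1_cst 1) (C1M (C1_cst (- 1)) (C1_comp is_derive_spos_sqr c2 Ct)).
apply: C1_ext (C1_comp is_derive_spos_sqr c2 Cs) => z;
  by rewrite /cutoff_slope /cutoff /ring_coord !expr2 /=
    ?mulN1r; ring.
Qed.

Lemma continuous_cutoff_slope (r : R) : continuous (cutoff_slope r).
Proof.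
have ct : continuous (ring_coord r).
  move=> z; apply: cvgB; last exact: cvg_cst.
  by apply: cvgM; [apply: cvgD; apply: cvg_sqr;
    [exact: cvg_fst|exact: cvg_snd]|exact: cvg_cst].
have cst : continuous (fun z => spos (ring_coord r z)).
  by move=> z; apply: continuous_comp; [exact: ct|exact: continuous_spos].
move=> z; apply: cvgM; first exact: cvg_cst.
apply: cvgM; last exact: cst.
apply: (@continuous_comp _ _ _ (fun z => 1 - spos (ring_coord r z) ^+ 2) spos).
  by apply: cvgB; [exact: cvg_cst|apply: cvg_sqr; exact: cst].
exact: continuous_spos.
Qed.

Lemma cutoff_ge0 (r : R) (z : R * R) : 0 <= cutoff r z.
Proof. exact: sqr_ge0. Qed.

Lemma enorm_ge0 (z : R * R) : 0 <= enorm z.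
Proof. exact: sqrtr_ge0. Qed.

Lemma sqr_enorm (z : R * R) : enorm z ^+ 2 = z.1 ^+ 2 + z.2 ^+ 2.
Proof. by rewrite sqr_sqrtr// addr_ge0// sqr_ge0. Qed.

Lemma cutoff_eq1 (r : R) (z : R * R) : 0 < r -> enorm z <= r -> cutoff r z = 1.
Proof.
move=> r0 zr; have t0 : ring_coord r z <= 0.
  rewrite /ring_coord -sqr_enorm subr_le0 ler_pdivrMr ?exprn_gt0// mul1r.
  by have := enorm_ge0 z; nra.
by rewrite /cutoff /spos (max_l t0) expr0n subr0 max_r// expr1n.
Qed.

Lemma cutoff_out (r : R) (z : R * R) : 0 < r -> 2 * r <= enorm z ->
  cutoff r z = 0 /\ cutoff_slope r z = 0.
Proof.
move=> r0 zr; have t1 : 1 <= ring_coord r z.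
  rewrite /ring_coord -sqr_enorm lerBrDr ler_pdivlMr ?exprn_gt0//; nra.
have s0 : spos (1 - spos (ring_coord r z) ^+ 2) = 0.
  rewrite /spos max_l// [Num.max 0 _]max_r; nra.
by rewrite /cutoff /cutoff_slope s0 expr0n mul0r mulr0.
Qed.

Lemma cutoff_slope_in (r : R) (z : R * R) : 0 < r -> enorm z < r ->
  cutoff_slope r z = 0.
Proof.
move=> r0 zr; have t0 : ring_coord r z <= 0.
  rewrite /ring_coord -sqr_enorm subr_le0 ler_pdivrMr ?exprn_gt0// mul1r.
  by have := enorm_ge0 z; nra.
by rewrite /cutoff_slope [spos (ring_coord r z)]/spos (max_l t0) !mulr0.
Qed.

(** With t the positive part of [ring_coord], the product of t and the positive part of 1 - t^2
    vanishes for t >= 1 and is at most 1 otherwise. *)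
Lemma cutoff_slope_bound (r : R) (z : R * R) : 0 < r ->
  `|cutoff_slope r z| <= 8 / r ^+ 2.
Proof.
move=> r0; rewrite /cutoff_slope normrM -[leRHS]mulr1 ler_pM//.
  by rewrite mulNr normrN ger0_norm// divr_ge0// sqr_ge0.
rewrite ler_norml; move: (ring_coord r z) => t; rewrite /spos.
by apply/andP; split; case: (leP 0 t) => ?; case: (leP 0 (1 - _)) => ?; nra.
Qed.

Lemma prod_norm_le_enorm (z : R * R) : `|z| <= enorm z.
Proof.
case: z => x y; rewrite prod_normE/= ge_max.
by apply/andP; split; rewrite -sqrtr_sqr ler_wsqrtr//= ?lerDl ?lerDr sqr_ge0.
Qed.

Lemma continuous_enorm (u : R * R -> R * R) :
  continuous (comp1 u) -> continuous (comp2 u) ->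
  continuous (fun z => enorm (u z)).
Proof.
move=> cu1 cu2 z.
apply: (@continuous_comp _ R R (fun z => (u z).1 ^+ 2 + (u z).2 ^+ 2) Num.sqrt);
  last exact: sqrt_continuous.
by apply: cvgD; apply: cvg_sqr; [exact: cu1|exact: cu2].
Qed.

Lemma measurable_eball (r : R) : measurable (eball r : set plane).
Proof.
have cn : continuous (fun z : R * R => enorm (id z)).
  by apply: continuous_enorm => z; [exact: cvg_fst|exact: cvg_snd].
apply: open_measurable_plane.
have -> : eball r = (fun z => enorm (id z)) @^-1` [set x : R | x < r] by [].
by move/continuousP: cn; apply; exact: open_lt.
Qed.

Lemma measurable_annulus (r s : R) :
  measurable (eball s `\` eball r : set plane).
Proof. by apply: measurableD; exact: measurable_eball. Qed.

(** * The Bernoulli function and integration by parts against the cutoff *)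

Definition bernoulli (u : R * R -> R * R) (p : R * R -> R) (z : R * R) : R :=
  p z + enorm (u z) ^+ 2 / 2.

Lemma continuous_oneDsqrV : continuous (fun s : R => (1 + s ^+ 2)^-1).
Proof.
move=> s; apply: cvgV; first by rewrite gt_eqF// ltr_pwDl// sqr_ge0.
by apply: cvgD; [exact: cvg_cst|apply: cvg_sqr; exact: cvg_id].
Qed.

Lemma atan_bound (s : R) : `|atan s| <= 2.
Proof.
have h2 := @pihalf_lt2 R; have := @atan_ltpi2 R s; have := @atan_gtNpi2 R s.
by move=> l1 l2; rewrite ler_norml; apply/andP; split; lra.
Qed.

(** Cauchy-Schwarz, read off from Lagrange's identity in dimension two. *)
Lemma dot_le (x y : R * R) : `|dot x y| <= enorm x * enorm y.
Proof.
rewrite -(@ler_pXn2r _ 2)// ?nnegrE ?mulr_ge0 ?enorm_ge0//.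
rewrite exprMn !sqr_enorm real_normK ?num_real// /dot.
rewrite -subr_ge0; have -> : (x.1 ^+ 2 + x.2 ^+ 2) * (y.1 ^+ 2 + y.2 ^+ 2) -
  (x.1 * y.1 + x.2 * y.2) ^+ 2 = (x.1 * y.2 - x.2 * y.1) ^+ 2 by ring.
exact: sqr_ge0.
Qed.

Lemma cutoff_sup (r : R) (z : R * R) : 0 < r -> 2 * r <= `|z| ->
  cutoff r z = 0 /\ cutoff_slope r z = 0.
Proof.
by move=> r0 zr; apply: cutoff_out => //; exact: le_trans (prod_norm_le_enorm z).
Qed.

Lemma integrable_cutoff (r : R) (f : R * R -> R) : 0 < r -> continuous f ->
  lebesgue2.-integrable [set: plane] (fun z => (cutoff r z * f z)%:E).
Proof.
move=> r0 cf; apply: (continuous_integrable_plane (fun z => cutoff r z * f z)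
  (2 * r)) => [z|z /(cutoff_sup _ _ r0)[-> _]]; last by rewrite mul0r.
by apply: cvgM; [case: (C1_cutoff r) => + _ _ _ _; exact|exact: cf].
Qed.

(** [X] and [Y] are the product-rule partial derivatives of [cutoff r] times [f], which is compactly
    supported even when [f] is not. *)
Lemma integral_cutoff_partial (r : R) (f fx fy : R * R -> R) :
  0 < r -> C1 f fx fy ->
  let X z := cutoff r z * fx z + f z * (cutoff_slope r z * z.1) in
  let Y z := cutoff r z * fy z + f z * (cutoff_slope r z * z.2) in
  [/\ lebesgue2.-integrable [set: plane] (EFin \o X),
      lebesgue2.-integrable [set: plane] (EFin \o Y),
      (\int[lebesgue2]_z (X z)%:E = 0)%E & (\int[lebesgue2]_z (Y z)%:E = 0)%E].
Proof.
move=> r0 Cf X Y; have C := C1M (C1_cutoff r) Cf.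
have out (z : R * R) : 2 * r <= `|z| ->
    [/\ cutoff r z * f z = 0, X z = 0 & Y z = 0].
  by move=> /(cutoff_sup _ _ r0); rewrite /X /Y => -[-> ->];
    rewrite !mul0r mulr0 addr0.
have [IX IY] := integral_partial_compact_support _ _ _ (2 * r) C out.
case: C => _ cX cY _ _; split => //.
- by apply: (continuous_integrable_plane X (2 * r) cX) => z /out[].
- by apply: (continuous_integrable_plane Y (2 * r) cY) => z /out[].
Qed.

(** * The energy identity and its bound by the annulus mean *)

Section Energy.
Variables (u : R * R -> R * R) (p : R * R -> R).
Hypotheses (smooth_u : smooth_field u) (smooth_p : smooth p).
Hypothesis euler_up : damped_euler u p.

Let a := comp1 u.
Let b := comp2 u.
Let B := bernoulli u p.
Let Ca : C1 a (partial1 a) (partial2 a) := Ck_C1 (smooth_u.1 1%N).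
Let Cb : C1 b (partial1 b) (partial2 b) := Ck_C1 (smooth_u.2 1%N).
Let Cp : C1 p (partial1 p) (partial2 p) := Ck_C1 (smooth_p 1%N).

(** This is - div (u atan B) for a solution. *)
Definition energy_density (z : R * R) : R := enorm (u z) ^+ 2 / (1 + B z ^+ 2).

Let CB : C1 B
  (fun z => partial1 p z + a z * partial1 a z + b z * partial1 b z)
  (fun z => partial2 p z + a z * partial2 a z + b z * partial2 b z).
Proof.
apply: C1_ext (C1D Cp (C1M (C1_cst 2^-1) (C1D (C1M Ca Ca) (C1M Cb Cb)))) => z.
- by rewrite /B /bernoulli sqr_enorm mulrC !expr2.
- by rewrite mulr0 addr0; field.
- by rewrite mulr0 addr0; field.
Qed.

Lemma continuous_energy_density : continuous energy_density.
Proof.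
move=> z; apply: cvgM.
  apply: cvg_sqr; apply: continuous_enorm.
  - by case: Ca.
  - by case: Cb.
apply: (@continuous_comp _ _ _ B (fun s : R => (1 + s ^+ 2)^-1)).
  by case: CB => + _ _ _ _; exact.
exact: continuous_oneDsqrV.
Qed.

Lemma energy_density_ge0 (z : R * R) : 0 <= energy_density z.
Proof. by rewrite divr_ge0// ?addr_ge0// sqr_ge0. Qed.

(** The divergence of cutoff * atan B * u has zero integral. It splits into minus the left
    integrand, where all derivatives fall on u atan B, and the right integrand, where they fall on
    the cutoff. *)
Lemma integral_energy_flux (r : R) : 0 < r ->
  (\int[lebesgue2]_z (cutoff r z * energy_density z)%:E =
   \int[lebesgue2]_z (atan (B z) * cutoff_slope r z * dot (u z) z)%:E)%E.
Proof.
move=> r0.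
have CatanB := C1_comp (@is_derive1_atan R) continuous_oneDsqrV CB.
have [iX _ IX _] := integral_cutoff_partial r _ _ _ r0 (C1M Ca CatanB).
have [_ iY _ IY] := integral_cutoff_partial r _ _ _ r0 (C1M Cb CatanB).
have ih := integrable_cutoff r _ r0 continuous_energy_density.
(* The two vanishing integrals of partial derivatives are added to the left side, so that only a
   pointwise identity of integrands remains. *)
rewrite -[LHS]adde0 -{1}IX -integralD_EFin// -[LHS]adde0 -IY -integralD_EFin//;
  last exact: (integrableD measurableT ih iX).
apply: eq_integral => z _; congr EFin => /=.
have [euler div0] := euler_up; have := div0 z; have := euler z.
rewrite /convection /grad /divergence /dot => /(congr1 (fun w => (w.1, w.2))) [].
rewrite -[partial1 (comp1 u)]/(partial1 a) -[partial2 (comp1 u)]/(partial2 a).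
rewrite -[partial1 (comp2 u)]/(partial1 b) -[partial2 (comp2 u)]/(partial2 b).
rewrite -[(u z).1]/(a z) -[(u z).2]/(b z) /= => e1 e2 d.
(* Momentum is solved for the pressure gradient and incompressibility for [partial2 b]. After
   substitution the cubic convection terms cancel against those of the gradient of |u|^2 / 2. *)
have {}e1 : partial1 p z = - (a z * partial1 a z + b z * partial2 a z + a z).
  by apply/eqP; rewrite -addr_eq0 addrC e1.
have {}e2 : partial2 p z = - (a z * partial1 b z + b z * partial2 b z + b z).
  by apply/eqP; rewrite -addr_eq0 addrC e2.
have {}d : partial2 b z = - partial1 a z.
  by apply/eqP; rewrite -addr_eq0 addrC d.
rewrite /energy_density sqr_enorm -[(u z).1]/(a z) -[(u z).2]/(b z).
by rewrite e1 e2 d; ring.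
Qed.

Lemma energy_le_annulus_mean (r : R) : 0 < r ->
  (\int[lebesgue2]_z (cutoff r z * energy_density z)%:E <=
   32%:E * annulus_mean u r)%E.
Proof.
move=> r0; rewrite integral_energy_flux//.
have ca : continuous a by case: Ca.
have cb : continuous b by case: Cb.
have cflux : continuous (fun z => atan (B z) * cutoff_slope r z * dot (u z) z).
  move=> z; apply: cvgM.
    apply: cvgM; last exact: continuous_cutoff_slope.
    apply: (@continuous_comp _ _ _ B (@atan R)).
      by case: CB => + _ _ _ _; exact.
    exact: continuous_atan.
  by apply: cvgD; apply: cvgM;
    by [exact: ca|exact: cb|exact: cvg_fst|exact: cvg_snd].
have mflux := continuous_measurable_plane _ cflux.
have men : measurable_fun [set: plane] (fun z => enorm (u z)).
  by apply: continuous_measurable_plane; exact: continuous_enorm.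
have mann : measurable (eball (2 * r) `\` eball r : set plane).
  exact: measurable_annulus.
apply: le_trans (lee_abs _) _.
apply: le_trans (le_abse_integral _ _ _) _ => //; first exact/measurable_EFinP.
rewrite /annulus_mean muleA -EFinM -ge0_integralZl_EFin//; last first.
  by rewrite mulr_ge0// invr_ge0 ltW.
  by apply/measurable_EFinP/measurable_funTS.
  by move=> z _; rewrite lee_fin enorm_ge0.
rewrite [leRHS]integral_mkcond; apply: ge0_le_integral => //.
- by apply/measurable_EFinP; apply: measurableT_comp.
- apply/(measurable_restrictT _ mann)/measurable_EFinP/measurable_funTS.
  by apply: measurable_funM.
move=> z _; rewrite patchE /=; case: ifPn => [|].
  rewrite inE => -[/= z2 _]; rewrite lee_fin normrM (normrM (atan _)).
  (* The constant 32 is 2 * 8 * 2: [atan] is bounded by 2, the slope by 8 / r^2, and |z| by 2 r on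
     the annulus. *)
  have -> : 32 / r * enorm (u z) = 2 * (8 / r ^+ 2) * (enorm (u z) * (2 * r)).
    by field; rewrite gt_eqF.
  apply: ler_pM; rewrite ?mulr_ge0//.
    by apply: ler_pM => //; [exact: atan_bound|exact: (cutoff_slope_bound r z r0)].
  by rewrite (le_trans (dot_le _ _))// ler_wpM2l ?enorm_ge0 ?ltW.
(* Off the annulus the slope vanishes: the cutoff is 0 beyond 2 r and constant inside radius r. *)
rewrite notin_setE /= not_andP => -[/negP|/contrapT z1].
  by rewrite -leNgt => /(cutoff_out _ _ r0) [_ ->]; rewrite mulr0 mul0r normr0.
by rewrite (cutoff_slope_in r z r0 z1) mulr0 mul0r normr0.
Qed.
End Energy.

(** * Vanishing of the velocity and constancy of the pressure *)

Lemma lebesgue2_ball (z : R * R) (d : R) : 0 <= d ->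
  lebesgue2 (ball z d) = (d *+ 2 * (d *+ 2))%:E.
Proof.
move=> d0; transitivity (lebesgue2 (ball z.1 d `*` ball z.2 d)).
  by rewrite -ball_prodE.
rewrite product_measure1E; try by apply: open_measurable; exact: ball_open.
by rewrite EFinM; congr (_ * _)%E; exact: lebesgue_measure_ball.
Qed.

Lemma enorm_le_prod_norm (z : R * R) : enorm z <= 2 * `|z|.
Proof.
rewrite -(@ler_pXn2r _ 2)// ?nnegrE ?mulr_ge0 ?enorm_ge0// sqr_enorm.
case: z => x y; have [hx hy] := prod_norm_ge x y; move: hx hy => /=.
move: `|(x, y)| => m hx hy.
rewrite -(real_normK (num_real x)) -(real_normK (num_real y)).
have := normr_ge0 x; have := normr_ge0 y; nra.
Qed.

(** If u were nonzero at [z0], the energy density would exceed some c > 0 on a square around it. For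
    large r the cutoff is 1 there, so the cut-off energy is bounded below independently of r, while
    small annulus means force it below that bound. *)
Lemma field_eq0 (u : R * R -> R * R) (p : R * R -> R) :
  smooth_field u -> smooth p -> damped_euler u p ->
  (forall e K : R, 0 < e -> exists2 r, K < r & (annulus_mean u r < e%:E)%E) ->
  forall z, u z = 0.
Proof.
move=> su sp eu small z0; apply/eqP/negPn/negP => uz0.
pose h := energy_density u p.
have h0 : 0 < h z0.
  rewrite /h /energy_density divr_gt0 ?ltr_pwDl ?sqr_ge0// sqr_enorm.
  rewrite lt_neqAle addr_ge0 ?sqr_ge0// andbT eq_sym paddr_eq0 ?sqr_ge0//.
  by rewrite !sqrf_eq0; apply: contra uz0; case: (u z0).
pose c := h z0 / 2.
have c0 : 0 < c by rewrite divr_gt0.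
have ch : continuous h by exact: continuous_energy_density.
have /nbhs_ballP[d /= d0 dc] : \forall z \near z0, c < h z.
  by have h0c : c < h z0 by [rewrite /c; lra]; exact: (cvgr_gt _ (ch z0) _ h0c).
have mV : measurable (ball z0 d : set plane) by exact: measurable_ball_plane.
have C0 : 0 < c * (d *+ 2 * (d *+ 2)) / 32.
  have d2 : 0 < d *+ 2 by rewrite mulr2n addr_gt0.
  by rewrite divr_gt0// mulr_gt0// mulr_gt0.
(* The threshold is c times the area of the square, divided by the 32 of the energy bound. Since
   [enorm] is at most twice the sup norm, r > 2 (|z0| + d) puts the square inside the Euclidean ball
   of radius r. *)
have [r Kr] := small (c * (d *+ 2 * (d *+ 2)) / 32) (2 * (`|z0| + d))
  C0.
have r0 : 0 < r.
  by apply: le_lt_trans Kr; rewrite mulr_ge0// addr_ge0// ltW.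
move=> mean_lt.
have := energy_le_annulus_mean u p su sp eu r r0; apply/negP; rewrite -ltNge.
apply: (@lt_le_trans _ _ (c * (d *+ 2 * (d *+ 2)))%:E).
  rewrite -[X in (_ < X%:E)%E](@divfK _ 32) ?pnatr_eq0// mulrC EFinM.
  by rewrite lte_pmul2l.
apply: (@le_trans _ _ (\int[lebesgue2]_(z in ball z0 d) c%:E)%E).
  rewrite (integral_cst lebesgue2 mV) EFinM lee_wpmul2l ?lee_fin ?(ltW c0)//.
  by rewrite -(lebesgue2_ball z0 _ (ltW d0)).
have mh : measurable_fun [set: plane] (fun z => cutoff r z * h z).
  apply: continuous_measurable_plane => z; apply: cvgM; last exact: ch.
  by case: (C1_cutoff r) => + _ _ _ _; exact.
apply: (@le_trans _ _ (\int[lebesgue2]_(z in ball z0 d)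
    (cutoff r z * h z)%:E)%E); last first.
  apply: ge0_subset_integral => //; first exact/measurable_EFinP.
  by move=> z _; rewrite lee_fin mulr_ge0 ?cutoff_ge0 ?energy_density_ge0.
apply: ge0_le_integral => //.
- by move=> z _; rewrite lee_fin ltW.
- exact/measurable_EFinP/measurable_funTS.
move=> z zV; rewrite lee_fin cutoff_eq1 ?mul1r ?(ltW (dc _ zV))//.
rewrite (le_trans (enorm_le_prod_norm z))// (le_trans _ (ltW Kr))// ler_pM2l//.
have : `|z0 - z| < d by move: zV; rewrite -ball_normE.
by have := ler_normB z0 (z0 - z); rewrite subKr; lra.
Qed.

(** With u = 0 the momentum equation reads grad p = 0. Going from (x, y) horizontally to (0, y),
    then vertically to the origin, does not change p. *)
Lemma pressure_constant (u : R * R -> R * R) (p : R * R -> R) :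
  smooth p -> damped_euler u p -> (forall z, u z = 0) ->
  exists c : R, forall z, p z = c.
Proof.
move=> sp [euler _] u0; have [_ _ _ d1 d2] := Ck_C1 (sp 1%N).
have grad0 z : partial1 p z = 0 /\ partial2 p z = 0.
  have h := euler z; have := congr1 fst h; have := congr1 snd h.
  by rewrite /convection u0 /dot /= !mul0r !add0r.
exists (p (0, 0)) => -[x y].
have px (s : R) : is_derive s 1 (fun s => p (s, y)) 0.
  by have := d1 s y; rewrite (grad0 _).1.
have py (s : R) : is_derive s 1 (fun s => p (0, s)) 0.
  by have := d2 0 s; rewrite (grad0 _).2.
by rewrite (is_derive_0_is_cst x 0 px) (is_derive_0_is_cst y 0 py).
Qed.

Lemma trivial_of_small_annulus_mean (u : R * R -> R * R) (p : R * R -> R) :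
  smooth_field u -> smooth p -> damped_euler u p ->
  (forall e K : R, 0 < e -> exists2 r, K < r & (annulus_mean u r < e%:E)%E) ->
  trivial_solution u p.
Proof.
move=> su sp eu small; have u0 := field_eq0 u p su sp eu small.
by split => //; exact: (pressure_constant u p sp eu u0).
Qed.

(** * Arbitrarily small annulus means, from the lower limit and from integrability *)

(** The infimum over the tail r > K is at most the lower limit 0, hence below e, so some r in that
    tail has a value below e. *)
Lemma limf_einf_small (f : R -> \bar R) (e K : R) :
  limf_einf f (pinfty_nbhs R) = 0%E -> 0 < e ->
  exists2 r, K < r & (f r < e%:E)%E.
Proof.
rewrite limf_einfE => f0 e0.
have : (ereal_inf (f @` [set r | (K < r)%R]) < e%:E)%E.
  apply: (@le_lt_trans _ _ 0%E); last by rewrite lte_fin.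
  rewrite -f0; apply: ereal_sup_ubound; exists [set r | (K < r)%R] => //.
  by exists K; split => //; exact: num_real.
by move=> /ereal_inf_lt[_ [r Kr <-] fr]; exists r.
Qed.

(* For [s <= 2] the weight [k] compensates [x ^ s] wherever [x > 1 / k]. *)
Lemma le_inv_add_powR (x k s : R) : 0 <= x -> 1 <= k -> 1 <= s -> s <= 2 ->
  x <= k^-1 + k * x `^ s.
Proof.
move=> x0 k1 s1 s2; have k0 : 0 < k by lra.
have xs0 : 0 <= x `^ s by exact: powR_ge0.
have kV0 : 0 < k^-1 by rewrite invr_gt0.
have [x1|x1] := leP 1 x.
  have := le1r_powR x1 s1; nra.
have [xk|xk] := leP x k^-1; first nra.
have xs : x ^+ 2 <= x `^ s.
  by rewrite -powR_mulrn// ger_powR// (ltW x1) (lt_trans kV0 xk).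
have kx : 1 < k * x by rewrite -ltr_pdivrMl// mulr1.
nra.
Qed.

Lemma annulus_mean_small (u : R * R -> R * R) (s : R) :
  continuous (fun z => enorm (u z)) -> 1 <= s -> s <= 2 -> Lr_field s u ->
  forall e K : R, 0 < e -> exists2 r, K < r & (annulus_mean u r < e%:E)%E.
Proof.
move=> cu s1 s2 [_ fu] e K e0.
pose f (z : plane) : \bar R := (enorm (u z) `^ s)%:E.
have f0 z : (0 <= f z)%E by rewrite lee_fin powR_ge0.
have men : measurable_fun [set: plane] (fun z => enorm (u z)).
  exact: continuous_measurable_plane.
have mf : measurable_fun [set: plane] f.
  apply/measurable_EFinP.
  by apply: (measurableT_comp (measurable_powR s)).
have If : (\int[lebesgue2]_z f z < +oo)%E.
  have sn0 : s != 0 by rewrite gt_eqF// (lt_le_trans ltr01).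
  have := poweR_lty s fu; rewrite poweR_Lnorm//.
  rewrite (eq_integral f)// => z _.
  by rewrite /f /= ger0_norm ?enorm_ge0.
pose I := fine (\int[lebesgue2]_z f z).
have IE : (\int[lebesgue2]_z f z = I%:E)%E.
  by rewrite fineK// ge0_fin_numE// integral_ge0.
pose D (n : nat) : set plane := eball n%:R.
have mD n : measurable (D n) by exact: measurable_eball.
have ndD : nondecreasing_seq D.
  move=> m n mn; apply/subsetPset => z; rewrite /D /eball /= => /lt_le_trans.
  by apply; rewrite ler_nat.
have UD : \bigcup_n D n = setT.
  apply/seteqP; split => // z _; exists (Num.trunc (enorm z)).+1 => //.
  by rewrite /D /eball/=; exact: truncnS_gt.
have cvgI : (\int[lebesgue2]_(z in D n) f z @[n --> \oo] --> I%:E)%E.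
  rewrite -IE -UD; apply: ge0_nondecreasing_set_cvg_integral => //.
  by move=> n; exact: measurable_funTS.
(* The final bound is 16 d + e' / d; these choices make it e/4 + e/2 < e. *)
pose d := e / 64.
have d0 : 0 < d by rewrite divr_gt0.
pose e' := d * e / 2.
have e'0 : 0 < e' by rewrite divr_gt0// mulr_gt0.
(* The bound n >= 1 makes the radius positive, and n >= d gives the weight r / d >= 1 required by
   [le_inv_add_powR]. *)
have [n [nI nK nd]] : exists n : nat,
    [/\ ((I - e')%:E < \int[lebesgue2]_(z in D n) f z)%E, K < n%:R & 
      Num.max 1 d <= n%:R].
  near \oo => n; exists n; split; near: n.
  - apply: (cvgI [set x | (I - e')%:E < x]%E); apply: open_ereal_gt'.
    by rewrite lte_fin; lra.
  - exact: nbhs_infty_gtr.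
  - exact: nbhs_infty_ger.
move: nd; rewrite ge_max => /andP[n1 nd].
pose r : R := n%:R; exists r => //.
have r0 : 0 < r by rewrite (lt_le_trans ltr01).
pose A : set plane := eball (2 * r) `\` eball r.
have mA : measurable A by exact: measurable_annulus.
(* The annulus is disjoint from [D n], whose integral already exceeds I - e', so at most e' of the
   total I is left for it. *)
have fA : (\int[lebesgue2]_(z in A) f z <= e'%:E)%E.
  have disj : [disjoint D n & A].
    by apply/disj_setPS => z [Dz [_ /(_ Dz)]].
  have : (\int[lebesgue2]_(z in D n `|` A) f z <= I%:E)%E.
    rewrite -IE; apply: ge0_subset_integral => //; exact: measurableU.
  rewrite ge0_integral_setU//; last exact: measurable_funTS.
  have : (0 <= \int[lebesgue2]_(z in A) f z)%E by exact: integral_ge0.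
  move: nI; set X := (\int[_]_(_ in _) _)%E; set Y := (\int[_]_(_ in _) _)%E.
  move: X Y => [X| |] [Y| |] //=; rewrite !(lte_fin, lee_fin) -?EFinD ?lee_fin//.
  by lra.
(* The annulus lies in a sup-norm ball of radius 2 r, a square of side 4 r. *)
have muA : (lebesgue2 A <= (16 * r ^+ 2)%:E)%E.
  have -> : 16 * r ^+ 2 = (2 * r) *+ 2 * ((2 * r) *+ 2) by ring.
  rewrite -(lebesgue2_ball 0 (2 * r)) ?mulr_ge0 ?(ltW r0)//.
  apply: le_measure; rewrite ?inE//; first exact: measurable_ball_plane.
  move=> z [z2 _]; rewrite -ball_normE /= sub0r normrN.
  exact: le_lt_trans (prod_norm_le_enorm z) z2.
have uA : (\int[lebesgue2]_(z in A) (enorm (u z))%:E <=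
    (d / r * (16 * r ^+ 2) + r / d * e')%:E)%E.
  apply: (@le_trans _ _
      (\int[lebesgue2]_(z in A) ((d / r)%:E + (r / d)%:E * f z))%E).
    apply: ge0_le_integral => //.
    - by move=> z _; rewrite lee_fin enorm_ge0.
    - exact/measurable_EFinP/measurable_funTS.
    - apply: measurable_funTS; apply: emeasurable_funD => //.
      exact: measurable_funeM.
    move=> z _; rewrite -EFinM -EFinD lee_fin.
    have rd1 : 1 <= r / d by rewrite ler_pdivlMr// mul1r.
    have := le_inv_add_powR (enorm (u z)) (r / d) s (enorm_ge0 _) rd1 s1 s2.
    by rewrite invf_div.
  rewrite ge0_integralD//; last first.
  - by apply: measurable_funeM; exact: measurable_funTS.
  - by move=> z _; rewrite mule_ge0// lee_fin divr_ge0 ?ltW.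
  - by move=> z _; rewrite lee_fin divr_ge0 ?ltW.
  rewrite (integral_cst lebesgue2 mA) ge0_integralZl_EFin//; last 2 first.
  - exact: measurable_funTS.
  - by rewrite divr_ge0 ?ltW.
  by rewrite EFinD !EFinM leeD// lee_wpmul2l// lee_fin divr_ge0 ?ltW.
rewrite /annulus_mean -/A; apply: (@le_lt_trans _ _
    ((r^-1)%:E * (d / r * (16 * r ^+ 2) + r / d * e')%:E)%E).
  by rewrite lee_wpmul2l// lee_fin invr_ge0 ltW.
rewrite -EFinM lte_fin.
have -> : r^-1 * (d / r * (16 * r ^+ 2) + r / d * e') = e / 4 + e / 2.
  by rewrite /e' /d; field; rewrite !gt_eqF.
lra.
Unshelve. all: by end_near. Qed.
End Plane.

Theorem theorem1p2 (R : realType) (u : R * R -> R * R) (p : R * R -> R)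
    (smooth_u : smooth_field u) (smooth_p : smooth p)
    (euler_up : damped_euler u p) :
  (limf_einf (annulus_mean u) (pinfty_nbhs R) = 0%E -> trivial_solution u p) /\
  (forall r : R, 1 <= r -> r <= 2 -> Lr_field r u -> trivial_solution u p).
Proof.
split=> [mean0|r r1 r2 ur];
  apply: trivial_of_small_annulus_mean => // e K e0.
  exact: limf_einf_small.
apply: annulus_mean_small r2 ur _ _ e0 => //.
by apply: continuous_enorm; [exact: (smooth_u.1 0%N)|exact: (smooth_u.2 0%N)].
Qed.
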